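(* Let $R$ be a unital $*$-ring and let $p,q\in R$ be projectors with $1-p-q\in R^\dag$. Then: (1) $pqp\in R^\dag$ and $(pqp)^\dag=p((1-p-q)^\dag)^2=((1-p-q)^\dag)^2p$; (2) if $pq$ is $*$-cancellable, then $pq\in R^\dag$ and $(pq)^\dag=qp((1-p-q)^\dag)^2$.
   Context: A unital $*$-ring is an associative (not necessarily commutative) ring $R$ with unity $1$ and an involution $a\mapsto a^*$ satisfying $(a^* )^*=a$, $(a+b)^*=a^*+b^*$, $(ab)^*=b^*a^*$. An element $a\in R$ is MP-invertible if there is $b\in R$ with $aba=a$, $bab=b$, $(ab)^*=ab$, $(ba)^*=ba$; such $b$ is unique and denoted $a^\dag$ (the Moore-Penrose inverse). $R^\dag$ is the set of MP-invertible elements of $R$. An element $p\in R$ is a projector if $p^2=p=p^*$. An element $a\in R$ is $*$-cancellable if, for all $x\in R$, $a^*ax=0$ implies $ax=0$, and $xaa^*=0$ implies $xa=0$. *)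

(* Defs.v *)
From HB Require Import structures.
From mathcomp Require Import all_boot ssralg.
From mathcomp Require Import boolp classical_sets.

Set Implicit Arguments.
Unset Strict Implicit.
Unset Printing Implicit Defensive.

Import GRing.Theory.
Local Open Scope ring_scope.

(* The base structure is [pzRingType], so the zero ring (1 = 0) is allowed. *)
HB.mixin Record PzRing_isStarRing R of GRing.PzRing R := {
  star : R -> R;
  starK : involutive star;
  starD : {morph star : a b / a + b};
  starM : forall a b, star (a * b) = star b * star a
}.

#[short(type="starRingType")]
HB.structure Definition StarRing :=
  { R of PzRing_isStarRing R & GRing.PzRing R }.

Section MoorePenrose.
Variable R : starRingType.
Implicit Types a b p x : R.

Definition projector p := p ^+ 2 = p /\ p = star p.

Definition is_mpinv a b :=
  [/\ a * b * a = a, b * a * b = b, star (a * b) = a * b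
    & star (b * a) = b * a].

Definition mp_invertible a := exists b, is_mpinv a b.

(* Total function: the Moore-Penrose inverse if [mp_invertible a], and the
   junk value 0 otherwise; see [mpinvP] and [mpinv_eq]. *)
Definition mpinv a : R := xget 0 [set b | is_mpinv a b].

Definition star_cancellable a :=
  (forall x, star a * a * x = 0 -> a * x = 0) /\
  (forall x, x * a * star a = 0 -> x * a = 0).

Lemma is_mpinv_uniq a b c : is_mpinv a b -> is_mpinv a c -> b = c.
Proof.
move=> [aba bab sab sba] [aca cac sac sca].
have eab : a * b = a * c.
  rewrite -sab -[in LHS]aca -(mulrA (a * c)) starM sab sac.
  by rewrite mulrA aba.
have eba : b * a = c * a.
  rewrite -sba -[in LHS]aca -mulrA mulrA starM sca sba.
  by rewrite -mulrA (mulrA a) aba.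
by rewrite -bab eba -mulrA eab mulrA cac.
Qed.

Lemma mpinvP a : mp_invertible a -> is_mpinv a (mpinv a).
Proof. by move=> ab; exact: (@xgetPex _ 0 [set b | is_mpinv a b] ab). Qed.

Lemma mpinv_eq a b : is_mpinv a b -> mpinv a = b.
Proof. by move=> ab; apply: (is_mpinv_uniq _ ab); apply: mpinvP; exists b. Qed.

End MoorePenrose.

(* Main.v *)
Require Import Defs.
From mathcomp Require Import all_boot ssralg.

(** Put [a = 1 - p - q], [A = a ^+ 2], [b] the Moore-Penrose inverse of [a] and
    [c = b ^+ 2].  As [a] is self-adjoint, [b] is self-adjoint and commutes
    with [a], so [c] is the Moore-Penrose inverse of [A] and [c] lies in the
    double commutant of [A].  Since [p * a = - (p * q)] and [q * a = - (q * p)],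
    both projectors commute with [A]: [p * A = p * q * p = A * p] and
    [q * A = q * p * q = A * q].  So everything commutes with [c] and the
    identities become direct, except [p * q = A * c * (p * q)], which is
    obtained by cancelling [star (p * q)] on the right. *)

Import GRing.Theory.
Local Open Scope ring_scope.

Section StarRing.
Set Implicit Arguments.
Unset Strict Implicit.
Variable R : starRingType.
Implicit Types a b p q x : R.

Lemma star0 : star (0 : R) = 0.
Proof. by apply: (addrI (star 0)); rewrite -starD !addr0. Qed.

Lemma starN a : star (- a) = - star a.
Proof. by apply: (addrI (star a)); rewrite -starD !subrr star0. Qed.

Lemma starB a b : star (a - b) = star a - star b.
Proof. by rewrite starD starN. Qed.

Lemma star1 : star (1 : R) = 1.
Proof. by rewrite -[LHS]mul1r -[X in X * _]starK -starM mul1r starK. Qed.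

Lemma is_mpinv_star a b : is_mpinv a b -> is_mpinv (star a) (star b).
Proof.
by case=> aba bab sab sba; split; rewrite -!starM ?mulrA ?aba ?bab ?sab ?sba.
Qed.

Lemma is_mpinv_selfadj a b : star a = a -> is_mpinv a b -> star b = b.
Proof.
move=> sa mab; apply: (is_mpinv_uniq _ mab).
by rewrite -{1}sa; apply: is_mpinv_star.
Qed.

(** The product [a * b] is self-adjoint, and its star [star b * star a] is [b * a]. *)
Lemma is_mpinv_selfadj_comm a b :
  star a = a -> is_mpinv a b -> GRing.comm a b.
Proof.
move=> sa mab; case: (mab) => _ _ sab _.
by rewrite /GRing.comm -sab starM sa (is_mpinv_selfadj sa mab).
Qed.

(** By commutation [a ^+ 2 * b ^+ 2] collapses to the idempotent [a * b], and so does the product in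
    the other order. *)
Lemma is_mpinv_sqr a b :
  GRing.comm a b -> is_mpinv a b -> is_mpinv (a ^+ 2) (b ^+ 2).
Proof.
move=> cab [aba bab sab sba].
have ee : a * b * (a * b) = a * b by rewrite mulrA aba.
have AC : a ^+ 2 * b ^+ 2 = a * b by rewrite -exprMn_comm // expr2 ee.
have CA : b ^+ 2 * a ^+ 2 = a * b.
  by rewrite -exprMn_comm; [rewrite -cab expr2 ee | exact/commr_sym].
split; rewrite ?AC ?CA //; first by rewrite expr2 mulrA aba.
by rewrite cab expr2 mulrA bab.
Qed.

(** With [e = a * b], both [x * e] and [e * x] equal [e * x * e]. Then [x * b = x * e * b = e * x *
    b = b * x * e = b * e * x = b * x]. *)
Lemma is_mpinv_comm2 a b x :
  GRing.comm a b -> is_mpinv a b -> GRing.comm x a -> GRing.comm x b.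
Proof.
move=> cab [aba bab _ _] cxa.
have xe : x * (a * b) = a * b * (x * (a * b)).
  by rewrite [x * (a * b)]mulrA cxa !mulrA aba.
have ex : a * b * x = a * b * (x * (a * b)).
  rewrite {1}cab -mulrA -cxa -{1}aba -(mulrA a) -cab !mulrA.
  by rewrite -(mulrA b x a) cxa !mulrA -cab.
have {xe ex} exC : x * (a * b) = a * b * x by rewrite xe ex.
rewrite /GRing.comm -[in LHS]bab -cab mulrA exC cab -!mulrA (mulrA a).
by rewrite -cxa -mulrA exC !mulrA bab.
Qed.

Lemma projector_mul_1B p q : projector p -> p * (1 - p - q) = - (p * q).
Proof. by case=> pp _; rewrite !mulrBr mulr1 -expr2 pp subrr sub0r. Qed.

Lemma projector_1B_mul p q : projector p -> (1 - p - q) * p = - (q * p).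
Proof. by case=> pp _; rewrite !mulrBl mul1r -expr2 pp subrr sub0r. Qed.

Lemma projector_mul_sqr_1B p q :
  projector p -> projector q -> p * (1 - p - q) ^+ 2 = p * q * p.
Proof.
move=> hp hq; rewrite expr2 mulrA projector_mul_1B // mulNr -(mulrA p q (_ - q)).
(* Written as [1 - q - p], the same element falls under the same lemma with [p] and [q]
   exchanged. *)
by rewrite (addrAC 1) projector_mul_1B // mulrN opprK mulrA.
Qed.

Lemma projector_sqr_1B_mul p q :
  projector p -> projector q -> (1 - p - q) ^+ 2 * p = p * q * p.
Proof.
move=> hp hq; rewrite expr2 -mulrA projector_1B_mul // mulrN mulrA.
by rewrite (addrAC 1) projector_1B_mul // mulNr opprK.
Qed.

(** On elements commuting with the idempotent [p], multiplication by [p] preserves products, so the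
    equations for [A] and [c] pass to [p * A] and [p * c]. *)
Lemma is_mpinv_pqp p q A c :
    projector p -> GRing.comm A c -> is_mpinv A c ->
    GRing.comm p A -> GRing.comm p c -> p * A = p * q * p ->
  is_mpinv (p * q * p) (p * c).
Proof.
move=> [pp sp] cAc [AcA cAc' sAc _] cpA cpc <-.
have mulp x y : GRing.comm p x -> p * x * (p * y) = p * (x * y).
  by move=> cpx; rewrite {1}cpx -mulrA (mulrA p) -expr2 pp mulrA -cpx mulrA.
have cpAc : GRing.comm p (A * c) by exact: commrM.
have cpcA : GRing.comm p (c * A) by exact: commrM.
by split; rewrite !mulp ?AcA ?cAc' // -?cAc starM sAc -sp cpAc.
Qed.

Lemma is_mpinv_pq p q A c :
    projector p -> projector q -> GRing.comm A c -> is_mpinv A c ->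
    GRing.comm p A -> GRing.comm q A -> GRing.comm p c -> GRing.comm q c ->
    p * A = p * q * p -> q * A = q * p * q -> star_cancellable (p * q) ->
  is_mpinv (p * q) (q * p * c).
Proof.
move=> [pp sp] [qq sq] cAc [AcA cAc' sAc _] cpA cqA cpc cqc pA qA [_ can].
have cpe : GRing.comm p (A * c) by exact: commrM.
have cqe : GRing.comm q (A * c) by exact: commrM.
have pqx : p * q * (q * p * c) = p * (A * c).
  by rewrite !mulrA -(mulrA p q q) -expr2 qq -pA.
have xpq : q * p * c * (p * q) = q * (A * c).
  rewrite -(mulrA (q * p)) (mulrA c) -cpc -(mulrA p) -cqc !mulrA.
  by rewrite -(mulrA q p p) -expr2 pp -qA.
have epq : A * c * (p * q) = p * q.
  (* Cancellability is applied to [x = A * c - 1]: here [p * q * star (p * q) = p * q * p = A * p],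
     which [x] annihilates because [A * c * A = A]. *)
  apply/eqP; rewrite -subr_eq0 -{2}[p * q]mul1r -mulrBl; apply/eqP; apply: can.
  rewrite starM -sp -sq -!mulrA (mulrA q q) -expr2 qq (mulrA p) -pA cpA.
  by rewrite mulrA mulrBl AcA mul1r subrr mul0r.
split; rewrite ?pqx ?xpq.
- by rewrite cpe -mulrA (mulrA p) -expr2 pp epq.
(* Move [A * c] to the right past [q] and [p], where [c * A * c = c] absorbs it. *)
- rewrite cqe !mulrA -(mulrA (A * c) q q) -expr2 qq -cqe -(mulrA q _ p).
  by rewrite -cpe !mulrA -!mulrA (mulrA A) cAc cAc'.
- by rewrite starM sAc -sp cpe.
- by rewrite starM sAc -sq cqe.
Qed.

End StarRing.

Theorem theorem3p12 (R : starRingType) (p q : R)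
    (hp : projector p) (hq : projector q)
    (hpq : mp_invertible (1 - p - q)) :
  [/\ mp_invertible (p * q * p),
      mpinv (p * q * p) = p * mpinv (1 - p - q) ^+ 2
    & p * mpinv (1 - p - q) ^+ 2 = mpinv (1 - p - q) ^+ 2 * p] /\
  (star_cancellable (p * q) ->
     mp_invertible (p * q) /\
     mpinv (p * q) = q * p * mpinv (1 - p - q) ^+ 2).
Proof.
have mab := mpinvP hpq.
set b := mpinv _ in mab *; set a := 1 - p - q in mab.
have sa : star a = a by rewrite !starB star1 -(proj2 hp) -(proj2 hq).
have cab := is_mpinv_selfadj_comm sa mab.
have mAc := is_mpinv_sqr cab mab.
have cAc : GRing.comm (a ^+ 2) (b ^+ 2) by apply/commrX/commr_sym/commrX/commr_sym.
have pA : p * a ^+ 2 = p * q * p by exact: projector_mul_sqr_1B.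
have qA : q * a ^+ 2 = q * p * q by rewrite /a (addrAC 1) projector_mul_sqr_1B.
have cpA : GRing.comm p (a ^+ 2).
  by rewrite /GRing.comm pA projector_sqr_1B_mul.
have cqA : GRing.comm q (a ^+ 2).
  by rewrite /GRing.comm qA /a (addrAC 1) projector_sqr_1B_mul.
have cpc := is_mpinv_comm2 cAc mAc cpA.
have cqc := is_mpinv_comm2 cAc mAc cqA.
have m1 := is_mpinv_pqp hp cAc mAc cpA cpc pA.
(* The last identity of (1) is [cpc]. *)
split=> [|can]; first by split; [exists (p * b ^+ 2) | exact: mpinv_eq |].
have m2 := is_mpinv_pq hp hq cAc mAc cpA cqA cpc cqc pA qA can.
by split; [exists (q * p * b ^+ 2) | exact: mpinv_eq].
Qed.
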